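(* Let $A$ be a discrete valuation ring in which $2$ is a unit, with an involution $*$ and uniformiser $y$, where $y^*=-y$ if $*$ is nontrivial. Let $V$ be a free $A$-module of finite rank $m>0$, let $\varepsilon\in\{1,-1\}$ and let $h:V\times V\to A$ be an $\varepsilon$-hermitian form (possibly degenerate). (1) If $*$ is unramified, then $V$ has a basis whose Gram matrix with respect to $h$ is diagonal. (2) If $*$ is ramified, then $V$ has a basis whose Gram matrix with respect to $h$ is the direct sum of a diagonal matrix (possibly of size zero) and a number (possibly zero) of $2\times 2$ blocks, each of the form $y^dB$, where $d\ge 0$ is an integer and $B$ is an invertible skew hermitian $2\times 2$ matrix over $A$ ($d$ and $B$ may depend on the block).
   Context: $\mathfrak r$ denotes the maximal ideal of $A$; a uniformiser is a generator of $\mathfrak r$. An involution of $A$ is a ring automorphism $a\mapsto a^*$ of order at most two (the identity is allowed, and is called trivial). Let $S=\{a\in A: a^*=-a\}$. The involution $*$ is ramified if $S\subset\mathfrak r$ (equivalently, the involution induced on $A/\mathfrak r$ is trivial), and unramified otherwise. If $*$ is nontrivial, $A$ always has a uniformiser $y$ with $y^*=-y$. A map $h:V\times V\to A$ is an $\varepsilon$-hermitian form if it is bi-additive, $A$-linear in the second variable, and $h(v,u)=\varepsilon h(u,v)^*$ for all $u,v\in V$. The Gram matrix of $v_1,\dots,v_k$ has $(i,j)$-entry $h(v_i,v_j)$. A square matrix $C$ is skew hermitian if $C'^*=-C$, where $C'$ is the transpose and $*$ is applied entrywise. *)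

(* Defs.v *)
From HB Require Import structures.
From mathcomp Require Import all_boot all_order all_algebra.

Set Implicit Arguments.
Unset Strict Implicit.
Unset Printing Implicit Defensive.

Import GRing.Theory.
Local Open Scope ring_scope.

(* Ideals are Prop-valued, so that quantification over ideals is not restricted
   to decidable ones (and, unlike idealr in ring_quotient, need not be proper). *)
Definition is_ideal (A : comNzRingType) (I : A -> Prop) : Prop :=
  [/\ I 0, forall a b, I a -> I b -> I (a + b) & forall a b, I b -> I (a * b)].

Definition generates (A : comNzRingType) (b : A) (I : A -> Prop) : Prop :=
  forall a, I a <-> exists c, a = c * b.

Definition is_maximal_ideal (A : comNzRingType) (I : A -> Prop) : Prop :=
  [/\ is_ideal I, ~ I 1 &
      forall J : A -> Prop, is_ideal J -> ~ J 1 ->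
        (forall a, I a -> J a) -> forall a, J a -> I a].

(* A is a principal ideal domain whose only maximal ideal is r, and r != 0. *)
Record is_dvr (A : idomainType) (r : A -> Prop) : Prop := IsDvr {
  dvr_principal : forall I : A -> Prop, is_ideal I -> exists b, generates b I;
  dvr_maximal : is_maximal_ideal r;
  dvr_local : forall I : A -> Prop, is_maximal_ideal I -> forall a, I a <-> r a;
  dvr_not_field : exists2 a, r a & a <> 0
}.

(* star is assumed to be an involution of A and r the maximal ideal of A. *)
Definition ramified (A : idomainType) (r : A -> Prop) (star : A -> A) : Prop :=
  forall a, star a = - a -> r a.

Definition is_basis (A : comNzRingType) (V : lmodType A) (n : nat)
    (v : 'I_n -> V) : Prop :=
  (forall c : 'I_n -> A, \sum_i c i *: v i = 0 -> forall i, c i = 0) /\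
  (forall u : V, exists c : 'I_n -> A, u = \sum_i c i *: v i).

Definition free_of_rank (A : comNzRingType) (V : lmodType A) (n : nat) : Prop :=
  exists v : 'I_n -> V, is_basis v.

(* Linearity is in the second variable; the hermitian forms of sesquilinear
   are linear in the first one. *)
Record eps_hermitian (A : comNzRingType) (V : lmodType A) (star : A -> A)
    (eps : A) (h : V -> V -> A) : Prop := EpsHermitian {
  herm_addl : forall u v w, h (u + v) w = h u w + h v w;
  herm_addr : forall u v w, h u (v + w) = h u v + h u w;
  herm_scaler : forall a u v, h u (a *: v) = a * h u v;
  herm_sym : forall u v, h v u = eps * star (h u v)
}.

Definition gram (A : comNzRingType) (V : lmodType A) (h : V -> V -> A)
    (n : nat) (v : 'I_n -> V) : 'M[A]_n :=
  \matrix_(i, j) h (v i) (v j).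

Definition skew_hermitian (A : comNzRingType) (star : A -> A) (n : nat)
    (C : 'M[A]_n) : Prop :=
  map_mx star C^T = - C.

(* Main.v *)
Require Import Defs.
From HB Require Import structures.
From mathcomp Require Import all_boot all_order all_algebra.
From mathcomp Require Import perm ring boolp.

(* Among the vectors not yet split off, pick an entry [b * y ^+ d] of the Gram
   matrix of minimal valuation, [b] a unit. As [star (y ^+ d) = +/- y ^+ d], the
   form divided by [y ^+ d] is [eps']-hermitian with [eps' = +/- 1]. If
   [w + eps' * star w] is a unit for some [w], then some diagonal entry can be
   made of valuation [d] by adding a multiple of one vector to another, and this
   vector splits off orthogonally. Otherwise, as [2] is a unit, [eps' = -1] (try
   [w = 1]) and every skew element lies in the maximal ideal (try a skew unit), so
   that the diagonal has larger valuation and the two vectors involved span a block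
   [y ^+ d *: B] with [B] invertible and skew hermitian, which splits off. *)

Set Implicit Arguments.
Unset Strict Implicit.
Unset Printing Implicit Defensive.

Import GRing.Theory.
Local Open Scope ring_scope.

(** * Discrete valuation rings *)

Section Dvr.

Variables (A : idomainType) (r : A -> Prop).
Hypothesis hA : is_dvr r.

Lemma max_ideal_is_ideal : is_ideal r.
Proof. by case: hA => _ [? _ _] _ _. Qed.

Lemma max_ideal_mull a b : r b -> r (a * b).
Proof. by case: max_ideal_is_ideal => _ _; apply. Qed.

Lemma max_idealD a b : r a -> r b -> r (a + b).
Proof. by case: max_ideal_is_ideal => _ + _; apply. Qed.

Lemma max_idealB a b : r a -> r b -> r (a - b).
Proof.
by move=> ra rb; rewrite -mulN1r; apply: max_idealD => //; apply: max_ideal_mull.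
Qed.

Lemma max_ideal_not_unit a : r a -> a \isn't a GRing.unit.
Proof.
case: (dvr_maximal hA) => _ r1 _ ra; apply/negP => ua; apply: r1.
by rewrite -(mulVr ua); apply: max_ideal_mull.
Qed.

Definition multiples (x : A) : A -> Prop := fun b => exists c, b = c * x.

Lemma multiples_ideal x : is_ideal (multiples x).
Proof.
split; first by exists 0; rewrite mul0r.
- by move=> _ _ [c ->] [d ->]; exists (c + d); rewrite mulrDl.
- by move=> a _ [c ->]; exists (a * c); rewrite mulrA.
Qed.

Lemma multiples_refl x : multiples x x.
Proof. by exists 1; rewrite mul1r. Qed.

Lemma multiples_trans z x w : multiples x z -> multiples z w -> multiples x w.
Proof. by move=> [c ->] [d ->]; exists (d * c); rewrite mulrA. Qed.

(* If no maximal ideal contained [a], one could build a strictly increasing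
   sequence of proper principal ideals containing [a]; their union is principal,
   which is absurd. *)
Lemma nonunit_max_ideal a : a \isn't a GRing.unit -> r a.
Proof.
move=> ua; apply: contrapT => ra.
pose proper x := x \isn't a GRing.unit /\ multiples x a.
(* Were [multiples x] maximal, it would be [r] by locality and [r] would contain [a]. The value [0]
   is a default for [x] not proper. *)
have step x : exists x', proper x ->
    [/\ proper x', multiples x' x & ~ multiples x x'].
  case: (lem (proper x)) => [[ux xa]|]; last by exists 0.
  apply: contrapT => nx'; apply: ra; apply/(dvr_local hA (I := multiples x)) => //.
  split; first exact: multiples_ideal.
    by case=> c c1; move/negP: ux; apply; apply/unitrPr; exists c; rewrite mulrC.
  move=> J idJ J1 xJ b Jb; apply: contrapT => xb; apply: nx'.
  have [x' Jx'] := dvr_principal hA idJ; exists x' => _.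
  have x'x : multiples x' x by apply/Jx'/xJ/multiples_refl.
  split=> //; last first.
    by move=> xx'; apply: xb; apply: multiples_trans xx' _; apply/Jx'.
  split; last exact: multiples_trans xa.
  apply/negP => ux'; apply: J1; apply/Jx'.
  by exists x'^-1; rewrite mulVr.
have [f fP] := choice step.
pose s n := iter n f a.
have sP n : proper (s n).
  elim: n => [|n IHn]; first by split; last exact: multiples_refl.
  by case: (fP _ IHn).
have s_le m n : (m <= n)%N -> multiples (s n) (s m).
  move/subnK <-; elim: (n - m)%N => [|k IHk]; first exact: multiples_refl.
  by apply: multiples_trans IHk; case: (fP _ (sP (k + m)%N)).
have idU : is_ideal (fun b => exists n, multiples (s n) b).
  split; first by exists 0%N, 0; rewrite mul0r.
  - move=> b c [m mb] [n nc]; exists (maxn m n).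
    have [_ D _] := multiples_ideal (s (maxn m n)).
    by apply: D; [apply: multiples_trans mb | apply: multiples_trans nc];
      apply: s_le; rewrite ?leq_maxl ?leq_maxr.
  - by move=> b c [m mc]; exists m; have [_ _] := multiples_ideal (s m); apply.
have [b bP] := dvr_principal hA idU.
have [n nb] : exists n, multiples (s n) b by apply/bP; exact: multiples_refl.
(* Every element of the union, [s n.+1] included, is a multiple of [b], hence of [s n], against
   strictness. *)
have [_ _] := fP _ (sP n); apply; apply: multiples_trans nb _.
by apply/bP; exists n.+1; exact: multiples_refl.
Qed.

Lemma unit_not_max_ideal a : ~ r a -> a \is a GRing.unit.
Proof. by move=> ra; apply/negPn/negP => /nonunit_max_ideal. Qed.

Variable y : A.
Hypothesis hy : generates y r.

Lemma uniformizer_max_ideal : r y.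
Proof. by apply/hy; exact: multiples_refl. Qed.

Lemma uniformizer_neq0 : y != 0.
Proof.
apply/eqP => y0; case: (dvr_not_field hA) => a /hy [c ->].
by rewrite y0 mulr0.
Qed.

(* If [y ^+ n] divided [a] for every [n], the quotients [a / y ^+ n] would
   generate a principal ideal, forcing [y] to be a unit. *)
Lemma valuation_exists a : a != 0 ->
  exists n, exists2 u, u \is a GRing.unit & a = u * y ^+ n.
Proof.
move=> a0; apply: contrapT => na.
have y0 := uniformizer_neq0.
have yn n : multiples (y ^+ n) a.
  elim: n => [|n [t at_]]; first by exists a; rewrite mulr1.
  case: (lem (r t)) => [/hy [c tc]|rt]; first by exists c; rewrite exprS mulrA -tc.
  by case: na; exists n, t => //; exact: unit_not_max_ideal.
pose I b := exists n, multiples a (b * y ^+ n).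
have idI : is_ideal I.
  split; first by exists 0%N, 0; rewrite !mul0r.
  - move=> b c [m [b' eb]] [n [c' ec]]; exists (m + n)%N.
    exists (b' * y ^+ n + c' * y ^+ m).
    rewrite mulrDl exprD mulrA eb mulrCA ec; ring.
  - by move=> b c [n [c' ec]]; exists n, (b * c'); rewrite -!mulrA ec.
have [b bP] := dvr_principal hA idI.
have [n [c ec]] : I b by apply/bP; exact: multiples_refl.
have [t' et'] := yn n.+1.
have [e ee] : multiples b t'.
  by apply/bP; exists n.+1; rewrite -et'; exact: multiples_refl.
have t'0 : t' != 0 by apply: contraNneq a0 => t'0; rewrite et' t'0 mul0r.
(* With [t' = e * b] this makes [e * c] an inverse of [y]. *)
have eb : b = c * y * t'.
  apply: (mulIf (expf_neq0 n y0)); rewrite ec et' exprS; ring.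
have /negP := max_ideal_not_unit uniformizer_max_ideal; apply.
apply/unitrPr; exists (e * c); apply: (mulIf t'0).
by rewrite mul1r {2}ee eb; ring.
Qed.

End Dvr.

(** * Bases and forms *)

Section Basis.

Variables (A : comNzRingType) (V : lmodType A).

(** On coefficients a shear changes only the entry at [i0]; this reduces both halves of
    [shear_basis] to coefficients. *)
Lemma shear_sum (n : nat) (v : 'I_n -> V) (i0 : 'I_n) (x a : 'I_n -> A) :
  \sum_l a l *: (v l + x l *: v i0) =
  \sum_l (a l + (l == i0)%:R * \sum_k a k * x k) *: v l.
Proof.
under eq_bigr do rewrite scalerDr scalerA.
under [RHS]eq_bigr do rewrite scalerDl.
rewrite !big_split /= -scaler_suml; congr (_ + _); set s := \sum_k _.
rewrite [RHS](bigD1 i0) //= eqxx mul1r big1 ?addr0 //.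
by move=> l /negPf ->; rewrite mul0r scale0r.
Qed.

Lemma shear_basis (n : nat) (v : 'I_n -> V) (i0 : 'I_n) (x : 'I_n -> A) :
  x i0 = 0 -> is_basis v -> is_basis (fun l => v l + x l *: v i0).
Proof.
move=> x0 [vfree vspan]; split=> [a|u].
  rewrite shear_sum => /vfree a0.
  have a0' l : l != i0 -> a l = 0.
    by move=> li; have := a0 l; rewrite (negPf li) mul0r addr0.
  move=> l; case: (eqVneq l i0) => [->|/a0' //].
  have := a0 i0; rewrite eqxx mul1r big1 ?addr0 // => k _.
  by case: (eqVneq k i0) => [->|/a0' ->]; rewrite ?x0 ?mulr0 ?mul0r.
have [a ->] := vspan u; pose s := \sum_k a k * x k.
(* The inverse shear: as [x i0 = 0], correcting the entry at [i0] does not alter [s]. *)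
exists (fun l => a l - (l == i0)%:R * s); rewrite shear_sum.
suff -> : \sum_k (a k - (k == i0)%:R * s) * x k = s.
  by apply: eq_bigr => l _; rewrite subrK.
under eq_bigr do rewrite mulrBl.
rewrite big_split /= -[RHS]addr0; congr (_ + _); rewrite big1 // => k _.
by case: (eqVneq k i0) => [->|_]; rewrite ?x0 ?mulr0 ?mul0r ?oppr0 ?mul0r.
Qed.

Lemma reindex_basis (n p : nat) (v : 'I_n -> V) (f : 'I_p -> 'I_n) :
  bijective f -> is_basis v -> is_basis (v \o f).
Proof.
move=> bf; have [g fK gK] := bf; move=> [vfree vspan]; split=> [a|u].
  rewrite (reindex g) /=; last by exists f => i _.
  under eq_bigr do rewrite gK.
  by move/(vfree (a \o g)) => a0 i; have := a0 (f i); rewrite /= fK.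
have [a ->] := vspan u; exists (a \o f).
by rewrite (reindex f) //=; exists g => i _.
Qed.

End Basis.

Section Form.

Variables (A : comNzRingType) (V : lmodType A) (star : {rmorphism A -> A}).
Variables (eps : A) (h : V -> V -> A).
Hypothesis hh : eps_hermitian star eps h.

Lemma herm_scalel a u w : h (a *: u) w = star a * h u w.
Proof.
by rewrite (herm_sym hh w) (herm_scaler hh) rmorphM (herm_sym hh w u) mulrCA.
Qed.

Lemma herm_sym0 u w : h u w = 0 -> h w u = 0.
Proof. by move=> huw; rewrite (herm_sym hh) huw rmorph0 mulr0. Qed.

End Form.

(** * Splitting off blocks *)

Section Split.

Variables (A : idomainType) (r : A -> Prop).
Hypothesis hA : is_dvr r.
Hypothesis h2 : (2%:R : A) \is a GRing.unit.
Variable star : {rmorphism A -> A}.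
Hypothesis hstar : involutive star.
Variable y : A.
Hypothesis hy : generates y r.
Hypothesis hystar : (exists a, star a <> a) -> star y = - y.
Variables (V : lmodType A) (eps : A) (h : V -> V -> A).
Hypothesis heps : eps = 1 \/ eps = -1.
Hypothesis hh : eps_hermitian star eps h.

(** The sign is [1] if [star] is trivial, and the [d]-th power of [-1] otherwise. *)
Lemma star_expr_uniformizer d :
  exists2 delta, delta = 1 \/ delta = -1 & star (y ^+ d) = delta * y ^+ d.
Proof.
have [e e1 ye] : exists2 e, e = 1 \/ e = -1 & star y = e * y.
  case: (lem (exists a, star a <> a)) => [/hystar yN|ys].
    by exists (-1); [right | rewrite yN mulN1r].
  exists 1; first by left.
  by rewrite mul1r; apply: contrapT => nys; case: ys; exists y.
exists (e ^+ d); last by rewrite rmorphXn ye exprMn.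
case: e1 => ->; first by left; rewrite expr1n.
by rewrite -signr_odd; case: odd; [right | left]; rewrite ?expr1 ?expr0.
Qed.

(** * Skew hermitian blocks of size two *)

Definition mx2 (a b c d : A) : 'M[A]_2 :=
  \matrix_(i, j) if i == 0 then (if j == 0 then a else b)
                 else (if j == 0 then c else d).

Lemma ord2P (i : 'I_2) : {i = 0} + {i = 1}.
Proof.
by case: i => [[|[|//]] ?]; [left | right]; apply: val_inj.
Qed.

Lemma unitmx_mx2 a b c d :
  a * d - b * c \is a GRing.unit -> mx2 a b c d \in unitmx.
Proof.
move=> u; set D := a * d - b * c in u.
have: mx2 a b c d *m (D^-1 *: mx2 d (- b) (- c) a) = 1%:M.
  rewrite -scalemxAr -(mulVr u) /D.
  apply/matrixP => i j; rewrite !mxE !big_ord_recl big_ord0 !mxE /=.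
  by case: (ord2P i) => ->; case: (ord2P j) => -> /=; ring.
by case/mulmx1_unit.
Qed.

Definition skew_block (u w : V) : Prop :=
  exists d B, [/\ B \in unitmx, skew_hermitian star B &
    gram h (fun i : 'I_2 => if i == 0 then u else w) = y ^+ d *: B].

(** By the sign condition, the form divided by [y ^+ d] is skew hermitian on [u], [w]. Its diagonal
    entries are skew, hence in [r] by ramification, so its determinant is a unit modulo [r]. The
    explicit entries serve to solve the linear system of [split_pair]. *)
Lemma skew_blockP d b u w : ramified r star ->
    eps * star (y ^+ d) = - y ^+ d ->
    b \is a GRing.unit -> h u w = b * y ^+ d ->
    multiples (y ^+ d) (h u u) -> multiples (y ^+ d) (h w w) ->
  skew_block u w /\
  exists a c, [/\ h u u = a * y ^+ d, h w w = c * y ^+ d,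
                  h w u = - star b * y ^+ d & a * c + b * star b \is a GRing.unit].
Proof.
move=> ram yd ub huw [a ha] [c hc].
have yd0 : y ^+ d != 0 by rewrite expf_neq0 // (uniformizer_neq0 hA hy).
have hs u1 w1 e : h u1 w1 = e * y ^+ d -> h w1 u1 = - star e * y ^+ d.
  by move=> e1; rewrite (herm_sym hh) e1 rmorphM mulrCA yd mulrN mulNr.
have skewE e u1 : h u1 u1 = e * y ^+ d -> star e = - e.
  move=> e1; apply: (mulIf yd0); rewrite mulNr -e1 (hs _ _ _ e1); ring.
have sa := skewE _ _ ha; have sc := skewE _ _ hc.
have ra : r a by apply: ram.
have uD : a * c + b * star b \is a GRing.unit.
  apply: (unit_not_max_ideal hA) => rD.
  have : r (b * star b).
    rewrite -[b * _](addKr (a * c)) addrC; apply: (max_idealB hA) => //.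
    by rewrite mulrC; apply: (max_ideal_mull hA).
  by move/(max_ideal_not_unit hA); rewrite unitrM ub rmorph_unit.
split; last by exists a, c; split => //; exact: hs.
exists d, (mx2 a b (- star b) c); split.
- by apply: unitmx_mx2; rewrite mulrN opprK.
- apply/matrixP => i j; rewrite !mxE.
  by case: (ord2P i) => ->; case: (ord2P j) => -> //=;
    rewrite ?rmorphN ?hstar ?opprK.
- apply/matrixP => i j; rewrite !mxE.
  case: (ord2P i) => ->; case: (ord2P j) => -> /=; rewrite mulrC //.
  exact: hs.
Qed.

(** * Partial splittings and their refinement *)

Variable m : nat.

(* The pairs [{i, sigma i}] outside [R] index the blocks already split off;
   the vectors indexed by [R] span their orthogonal complement. *)
Record partial_splitting (v : 'I_m -> V) (sigma : 'I_m -> 'I_m)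
    (R : {set 'I_m}) : Prop := PartialSplitting {
  split_basis : is_basis v;
  split_inv : involutive sigma;
  split_rest : forall i, i \in R -> sigma i = i;
  split_orth : forall i j, i \notin R -> j != i -> j != sigma i ->
    h (v i) (v j) = 0;
  split_block : forall i, sigma i != i ->
    ramified r star /\ skew_block (v i) (v (sigma i))
}.

Lemma split_orth_rest v sigma R i j : partial_splitting v sigma R ->
  i \notin R -> j \in R -> h (v i) (v j) = 0.
Proof.
move=> S iR jR; apply: (split_orth S) => //.
  by apply: contraNneq iR => <-.
by apply: contraNneq iR => ji; rewrite -(split_inv S i) -ji (split_rest S jR).
Qed.

Lemma split_moved v sigma R i : partial_splitting v sigma R ->
  sigma i != i -> i \notin R /\ sigma i \notin R.
Proof.
move=> S sii; have iR : i \notin R by apply: contra sii => /(split_rest S)/eqP.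
split=> //; apply: contra iR => siR.
by have := split_rest S siR; rewrite (split_inv S) => ->.
Qed.

(** One lemma for both block sizes: [i0 = i1] splits off a single vector. The block is asked for in
    both orders because [split_block] speaks of either member of a pair. *)
Lemma split_off v sigma R (i0 i1 : 'I_m) :
    partial_splitting v sigma R -> i0 \in R -> i1 \in R ->
    (i0 != i1 -> [/\ ramified r star, skew_block (v i0) (v i1)
                   & skew_block (v i1) (v i0)]) ->
    (forall l, exists xz : A * A,
       let w := v l + xz.1 *: v i0 + xz.2 *: v i1 in
       h (v i0) w = 0 /\ h (v i1) w = 0) ->
  exists v' sigma', partial_splitting v' sigma' (R :\: [set i0; i1]).
Proof.
move=> S R0 R1 blk /choice [xz xzP]; set T := [set i0; i1].
(* Setting the coefficients to zero off [R :\: T] keeps the old blocks and the new one unchanged. *)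
pose x l := if l \in R :\: T then (xz l).1 else 0.
pose z l := if l \in R :\: T then (xz l).2 else 0.
(* Two successive shears, so that [shear_basis] applies twice; [v1 i1] is still [v i1]. *)
pose v1 l := v l + x l *: v i0; pose v' l := v1 l + z l *: v1 i1.
have T0 : i0 \in T by rewrite !inE eqxx.
have T1 : i1 \in T by rewrite !inE eqxx orbT.
have xT l : l \in T -> x l = 0 by rewrite /x in_setD => ->.
have zT l : l \in T -> z l = 0 by rewrite /z in_setD => ->.
have v'E l : v' l = v l + x l *: v i0 + z l *: v i1.
  by rewrite /v' /v1 (xT i1) // scale0r addr0.
have v'out l : l \notin R :\: T -> v' l = v l.
  by move=> lRT; rewrite v'E /x /z (negPf lRT) !scale0r !addr0.
have TN l : l \in T -> l \notin R :\: T by rewrite in_setD => ->.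
have TR l : l \in T -> l \in R by rewrite !inE => /orP[] /eqP ->.
pose sigma' i := if i \in T then tperm i0 i1 i else sigma i.
have tT i : i \in T -> tperm i0 i1 i \in T.
  by rewrite !inE => /orP[] /eqP ->; rewrite ?tpermL ?tpermR eqxx ?orbT.
have sT i : i \notin T -> sigma i \notin T.
  apply: contra => siT; have := split_rest S (TR _ siT).
  by rewrite (split_inv S) => ->.
exists v', sigma'; split.
- apply: shear_basis; first exact: zT.
  by apply: shear_basis; [exact: xT | exact: split_basis S].
- move=> i; rewrite /sigma'; case: (boolP (i \in T)) => iT.
    by rewrite tT // tpermK.
  by rewrite (negPf (sT _ iT)) (split_inv S).
- move=> i; rewrite /sigma' in_setD => /andP[/negPf -> iR]; exact: split_rest S _ iR.
(* For [i] outside [R], the corrections of [v j] lie in the complement of [v i]; for [i] in [T], the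
   corrections were chosen for this. *)
- move=> i j; rewrite in_setD negb_and negbK orbC => iRT ji jsi.
  case: (boolP (i \in T)) => iT; last first.
    rewrite (negPf iT) orbF in iRT.
    rewrite v'out ?in_setD ?(negPf iRT) ?andbF // v'E.
    rewrite !(herm_addr hh) !(herm_scaler hh).
    rewrite (split_orth_rest S iRT R0) (split_orth_rest S iRT R1) !mulr0 !addr0.
    by apply: (split_orth S) => //; rewrite /sigma' (negPf iT) in jsi.
  rewrite v'out ?TN //.
  case: (boolP (j \in R :\: T)) => jRT.
    rewrite v'E /x /z jRT; case: (xzP j) => /= E0 E1.
    by case/set2P: iT => ->.
  rewrite v'out //; rewrite in_setD negb_and negbK in jRT.
  case: (boolP (j \in T)) => jT.
    move: ji jsi; rewrite /sigma' iT; case/set2P: iT => ->; case/set2P: jT => ->;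
    by rewrite ?tpermL ?tpermR ?eqxx.
  rewrite (negPf jT) /= in jRT.
  by apply: (herm_sym0 hh); apply: (split_orth_rest S jRT); apply: TR.
- move=> i; rewrite /sigma'; case: (boolP (i \in T)) => iT sii.
    rewrite !v'out ?TN ?tT //.
    case/set2P: iT sii => ->; rewrite ?tpermL ?tpermR => i01.
      by rewrite eq_sym in i01; case: (blk i01).
    by case: (blk i01).
  have [ram sb] := split_block S sii; split=> //.
  have [iR siR] := split_moved S sii.
  by rewrite !v'out ?in_setD ?(negPf iR) ?(negPf siR) ?andbF.
Qed.

(** The added vector [v j] is orthogonal to everything already split off. *)
Lemma shear_splitting v sigma R i j x : partial_splitting v sigma R ->
    i \in R -> j \in R -> i != j ->
  partial_splitting (fun l => v l + (if l == i then x else 0) *: v j) sigma R.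
Proof.
move=> S iR jR ij; set v' := fun l => _.
have v'out l : l != i -> v' l = v l.
  by rewrite /v' => /negPf ->; rewrite scale0r addr0.
have v'outR l : l \notin R -> v' l = v l.
  by move=> lR; apply: v'out; apply: contraNneq lR => ->.
split; [| exact: split_inv S | exact: split_rest S | |].
- apply: shear_basis (split_basis S).
  by rewrite eq_sym (negPf ij).
- move=> k l kR lk lsk; rewrite v'outR // (herm_addr hh) (herm_scaler hh).
  by rewrite (split_orth S) // (split_orth_rest S kR jR) mulr0 addr0.
- move=> k sk; have [kR skR] := split_moved S sk.
  by rewrite !v'outR //; exact: split_block S _ sk.
Qed.

(** A Gram-Schmidt step: [h (v i) (v i)] divides every [h (v i) (v l)], so the projection has its
    coefficient in [A]. *)
Lemma split_diag v sigma R d i u : partial_splitting v sigma R -> i \in R ->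
    u \is a GRing.unit -> h (v i) (v i) = u * y ^+ d ->
    (forall l, multiples (y ^+ d) (h (v i) (v l))) ->
  exists v' sigma', partial_splitting v' sigma' (R :\ i).
Proof.
move=> S iR uu hii hil; rewrite -[[set i]]setUid.
apply: (split_off S iR iR) => [|l]; first by rewrite eqxx.
have [c hc] := hil l; exists (- c / u, 0) => /=.
rewrite scale0r addr0 (herm_addr hh) (herm_scaler hh) hii hc.
suff -> : c * y ^+ d + - c / u * (u * y ^+ d) = 0 by [].
by rewrite mulrA divrK // mulNr subrr.
Qed.

Lemma split_pair v sigma R d i j b : partial_splitting v sigma R ->
    i \in R -> j \in R -> ramified r star -> eps * star (y ^+ d) = - y ^+ d ->
    b \is a GRing.unit -> h (v i) (v j) = b * y ^+ d ->
    (forall k l, k \in R -> multiples (y ^+ d) (h (v k) (v l))) ->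
  exists v' sigma', partial_splitting v' sigma' (R :\: [set i; j]).
Proof.
move=> S iR jR ram yd ub hij hkl.
have [sb [a [c [hii hjj hji uD]]]] :=
  skew_blockP ram yd ub hij (hkl _ i iR) (hkl _ j jR).
have ub' : - star b \is a GRing.unit by rewrite unitrN rmorph_unit.
have [sb' _] := skew_blockP ram yd ub' hji (hkl _ j jR) (hkl _ i iR).
apply: (split_off S iR jR) => [_|l]; first by split.
have [[p hp] [q hq]] := (hkl i l iR, hkl j l jR).
set D := a * c + b * star b in uD.
(* Cramer's rule for [p + x * a + z * b = 0] and [q - x * star b + z * c = 0], of determinant
   [D]. *)
pose x := (b * q - c * p) / D; pose z := (- a * q - star b * p) / D.
have xD : x * D = b * q - c * p by rewrite divrK.
have zD : z * D = - a * q - star b * p by rewrite divrK.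
have mulD e f g : (e * y ^+ d + x * (f * y ^+ d) + z * (g * y ^+ d)) * D =
    (e * D + x * D * f + z * D * g) * y ^+ d by ring.
exists (x, z) => /=.
rewrite !(herm_addr hh) !(herm_scaler hh) hii hjj hij hji hp hq.
by split; apply: (mulIr uD); rewrite mul0r mulD xD zD /D; ring.
Qed.

Lemma split_step v sigma R : partial_splitting v sigma R -> R != set0 ->
  exists v' sigma' (R' : {set 'I_m}),
    partial_splitting v' sigma' R' /\ (#|R'| < #|R|)%N.
Proof.
move=> S R0.
pose P d := exists i j u,
  [/\ i \in R, j \in R, u \is a GRing.unit & h (v i) (v j) = u * y ^+ d].
case: (lem (exists d, P d)) => [[d0 Pd0]|nP]; last first.
  (* The form vanishes on the rest, which is split off at once as zero diagonal entries. *)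
  exists v, sigma, set0; split; last by rewrite cards0 card_gt0.
  split; [exact: split_basis S | exact: split_inv S | by move=> i; rewrite inE | |
          exact: split_block S].
  move=> i j _ ji jsi; case: (boolP (i \in R)) => iR; last exact: split_orth S _ _ _ _ _.
  case: (boolP (j \in R)) => jR; last first.
    by apply: (herm_sym0 hh); apply: split_orth_rest S _ _.
  case: (eqVneq (h (v i) (v j)) 0) => // hij.
  have [d [u uu hE]] := valuation_exists hA hy hij.
  by case: nP; exists d, i, j, u.
have exP : exists d, `[< P d >] by exists d0; apply/asboolP.
case: (ex_minnP exP) => d /asboolP [i [j [b [iR jR ub hij]]]] dmin {d0 Pd0 exP}.
(* Minimality covers [l] in [R]; for other [l] the entry is zero. *)
have hkl k l : k \in R -> multiples (y ^+ d) (h (v k) (v l)).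
  move=> kR; case: (eqVneq (h (v k) (v l)) 0) => [->|hkl0].
    by exists 0; rewrite mul0r.
  have lR : l \in R.
    apply: contraNT hkl0 => lR; apply/eqP/(herm_sym0 hh).
    exact: split_orth_rest S _ _.
  have [n [u uu hE]] := valuation_exists hA hy hkl0; rewrite hE.
  have dn : (d <= n)%N.
    by apply: dmin; apply/asboolP; exists k, l, u; split=> //; exact: hE.
  by exists (u * y ^+ (n - d)); rewrite -mulrA -exprD subnK.
case: (lem (exists2 k, k \in R & exists2 u, u \is a GRing.unit &
              h (v k) (v k) = u * y ^+ d)) => [[k kR [u uu hkk]]|nD].
  have [v' [sigma' S']] := split_diag S kR uu hkk (fun l => hkl k l kR).
  by exists v', sigma', (R :\ k); split=> //; rewrite [ltnRHS](cardsD1 k) kR.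
have hdiag k : k \in R -> exists2 c, r c & h (v k) (v k) = c * y ^+ d.
  move=> kR; have [c hc] := hkl k k kR; exists c => //.
  apply: contrapT => rc; apply: nD; exists k => //; exists c => //.
  exact: unit_not_max_ideal hA _ rc.
have ij : i != j.
  by apply: contra_notN nD => /eqP ij; exists i => //; exists b; rewrite // {2}ij.
have [delta delta1 ydE] := star_expr_uniformizer d.
(* The symmetry sign of the form divided by [y ^+ d]. *)
pose eps' := eps * delta.
have hji : h (v j) (v i) = eps' * star b * y ^+ d.
  by rewrite (herm_sym hh) hij rmorphM ydE /eps'; ring.
have eps'1 : eps' = 1 \/ eps' = -1.
  by rewrite /eps'; case: heps => ->; case: delta1 => ->;
    rewrite ?mulrNN ?mulr1 ?mul1r; [left|right|right|left].
case: (lem (exists w, w + eps' * star w \is a GRing.unit)) => [[w uw]|nw].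
  (* Adding [x *: v j] to [v i] adds [w + eps' * star w], modulo [r], to the diagonal entry divided
     by [y ^+ d]. *)
  pose x := w / b.
  have S' := shear_splitting x S iR jR ij; set v' := fun l => _ in S'.
  have hkl' l : multiples (y ^+ d) (h (v' i) (v' l)).
    have [_ mD mM] := multiples_ideal (y ^+ d).
    rewrite /v' eqxx !(herm_addr hh) !(herm_addl hh).
    rewrite !(herm_scaler hh) !(herm_scalel hh).
    by do ![exact: hkl | apply: (mD) | apply: (mM)].
  have [ci rci hii] := hdiag i iR; have [cj rcj hjj] := hdiag j jR.
  have hii' : h (v' i) (v' i) =
      (w + eps' * star w + (ci + star x * x * cj)) * y ^+ d.
    rewrite /v' eqxx !(herm_addr hh) !(herm_addl hh).
    rewrite !(herm_scaler hh) !(herm_scalel hh) hii hjj hij hji.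
    have -> : w = x * b by rewrite divrK.
    by rewrite rmorphM; ring.
  have uu : w + eps' * star w + (ci + star x * x * cj) \is a GRing.unit.
    apply: (unit_not_max_ideal hA) => rs.
    suff /(max_ideal_not_unit hA) : r (w + eps' * star w) by rewrite uw.
    rewrite -[_ + _](addrK (ci + star x * x * cj)); apply: (max_idealB hA) => //.
    by apply: (max_idealD hA) => //; apply: (max_ideal_mull hA).
  have [v'' [sigma' S'']] := split_diag S' iR uu hii' hkl'.
  by exists v'', sigma', (R :\ i); split=> //; rewrite [ltnRHS](cardsD1 i) iR.
have eps'N : eps' = -1.
  by case: eps'1 => // e1; case: nw; exists 1; rewrite e1 rmorph1 mulr1.
have ram : ramified r star.
  (* For [a] skew and outside [r], [a - star a = 2 * a] would be a unit. *)
  move=> a sa; apply: contrapT => ra; apply: nw; exists a.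
  rewrite eps'N sa mulN1r opprK -[a + a]mulr2n -mulr_natl unitrM h2.
  exact: unit_not_max_ideal hA _ ra.
have yd : eps * star (y ^+ d) = - y ^+ d.
  by rewrite ydE mulrA -/eps' eps'N mulN1r.
have [v' [sigma' S']] := split_pair S iR jR ram yd ub hij hkl.
exists v', sigma', (R :\: [set i; j]); split=> //.
rewrite [ltnRHS](cardsD1 i) iR ltnS subset_leq_card //.
by apply/subsetP => k; rewrite !inE negb_or => /andP[/andP[-> _] ->].
Qed.

Lemma full_splitting (v : 'I_m -> V) : is_basis v ->
  exists v' sigma', partial_splitting v' sigma' set0.
Proof.
move=> bv.
(* Nothing is split off yet, so only the basis condition has content. *)
have: partial_splitting v id [set: 'I_m].
  by split=> // i; rewrite ?inE ?eqxx.
move: {bv} v id [set: 'I_m] => v sigma R.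
move: {2}#|R| (leqnn #|R|) => n; elim: n v sigma R => [|n IHn] v sigma R.
  by rewrite leqn0 cards_eq0 => /eqP -> S; exists v, sigma.
move=> leR S; have [R0|/(split_step S)] := eqVneq R set0.
  by rewrite R0 in S; exists v, sigma.
move=> [v' [sigma' [R' [S' ltR]]]]; apply: (IHn v' sigma' R') => //.
by rewrite -ltnS (leq_trans ltR).
Qed.

End Split.

(** * From an involution of the indices to block matrices *)

(* The fixed points of an involution followed by one pair [j, sigma j] for each
   [2]-cycle, listed by its smaller element [j]. *)
Definition involution_enum (m : nat) (sigma : 'I_m -> 'I_m) :
    let k := #|[set i | sigma i == i]| in
    let s := #|[set i : 'I_m | (i < sigma i)%N]| in
    'I_(k + \sum_(i < s) 2) -> 'I_m :=
  fun x => match split x with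
  | inl a => enum_val a
  | inr b => let j := enum_val (tagnat.sig1 b) in
             if (tagnat.sig2 b : 'I_2) == 0 then j else sigma j
  end.

Section InvolutionEnum.

Variables (m : nat) (sigma : 'I_m -> 'I_m).
Hypothesis sigmaK : involutive sigma.

Let k := #|[set i | sigma i == i]|.
Let s := #|[set i : 'I_m | (i < sigma i)%N]|.

(** The indices that [sigma] moves are those it raises and those it lowers, and [sigma] exchanges
    the two kinds. *)
Lemma card_involution : (k + 2 * s)%N = m.
Proof.
have injs : injective sigma := inv_inj sigmaK.
rewrite -[RHS]card_ord -(cardsC [set i | sigma i == i]).
congr (_ + _)%N; rewrite mul2n -addnn.
rewrite -(cardsID [set i : 'I_m | (i < sigma i)%N]); congr (_ + _)%N.
  apply: eq_card => i; rewrite !inE.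
  apply/idP/andP => [lti|[]//]; split=> //.
  by apply/eqP => si; rewrite si ltnn in lti.
rewrite /s -[LHS](card_imset _ injs); apply: eq_card => i.
apply/imsetP/idP => [[j]|]; rewrite !inE; last case/andP=> le_si ne_si.
  move=> ltj ->; rewrite sigmaK -leqNgt (ltnW ltj) /=.
  by apply/eqP => js; rewrite -js ltnn in ltj.
exists (sigma i); rewrite ?sigmaK // inE sigmaK.
by rewrite ltn_neqAle ne_si leqNgt.
Qed.

Lemma fixed_enum (a : 'I_k) : sigma (enum_val a) = enum_val a.
Proof. by apply/eqP; have := enum_valP a; rewrite inE. Qed.

Lemma pair_enum_lt (b : 'I_s) : (enum_val b < sigma (enum_val b))%N.
Proof. by have := enum_valP b; rewrite inE. Qed.

(** No index is both the smaller member of a pair and the larger member of one. *)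
Lemma pair_enum_neq (b b' : 'I_s) : enum_val b <> sigma (enum_val b').
Proof.
move=> bb'; have := pair_enum_lt b; rewrite bb' sigmaK.
by move=> /ltn_trans /(_ (pair_enum_lt b')); rewrite ltnn.
Qed.

Lemma involution_enum_bij : bijective (involution_enum (sigma := sigma)).
Proof.
apply: inj_card_bij; last first.
  by rewrite !card_ord sum_nat_const card_ord mulnC card_involution.
have nfix (b : 'I_s) (a : 'I_k) : enum_val b <> enum_val a.
  by move=> ba; have := pair_enum_lt b; rewrite ba fixed_enum ltnn.
have nfix' (b : 'I_s) (a : 'I_k) : sigma (enum_val b) <> enum_val a.
  by move/(congr1 sigma); rewrite sigmaK fixed_enum => /nfix.
(* The type of [tagnat.sig2 b] depends on [tagnat.sig1 b]; the cast to ['I_2] makes positions in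
   different blocks comparable. *)
have sig_inj (b b' : 'I_(\sum_(i < s) 2)) : tagnat.sig1 b = tagnat.sig1 b' ->
    (tagnat.sig2 b : 'I_2) = tagnat.sig2 b' -> b = b'.
  by move=> e1 e2; rewrite -(tagnat.sig2K b) -(tagnat.sig2K b');
    move: (tagnat.sig2 b) (tagnat.sig2 b') e2; rewrite e1 => ? ? ->.
move=> x1 x2 e12; rewrite -(splitK x1) -(splitK x2); move: e12.
rewrite /involution_enum.
case: (split x1) => [a1|b1]; case: (split x2) => [a2|b2].
- by move/enum_val_inj ->.
- by case: eqP => _ /esym; [move/nfix | move/nfix'].
- by case: eqP => _; [move/nfix | move/nfix'].
- case: (ord2P (tagnat.sig2 b1)) => z1; case: (ord2P (tagnat.sig2 b2)) => z2;
    rewrite z1 z2 /=.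
  + by move/enum_val_inj => e; congr (unsplit (inr _)); apply: sig_inj; rewrite ?z1.
  + by move/pair_enum_neq.
  + by move/esym/pair_enum_neq.
  + move/(inv_inj sigmaK)/enum_val_inj => e; congr (unsplit (inr _)).
    by apply: sig_inj; rewrite ?z1.
Qed.

End InvolutionEnum.

(** * Reading both normal forms off a full splitting *)

Theorem theorem3 (A : idomainType) (r : A -> Prop) (hA : is_dvr r)
    (h2 : (2%:R : A) \is a GRing.unit)
    (star : {rmorphism A -> A}) (hstar : involutive star)
    (y : A) (hy : generates y r)
    (hystar : (exists a, star a <> a) -> star y = - y)
    (V : lmodType A) (m : nat) (hm : (0 < m)%N) (hV : free_of_rank V m)
    (eps : A) (heps : eps = 1 \/ eps = -1)
    (h : V -> V -> A) (hh : eps_hermitian star eps h) :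
  (~ ramified r star ->
     exists e : 'I_m -> V, is_basis e /\ is_diag_mx (gram h e))
  /\
  (ramified r star ->
     exists (k s : nat) (e : 'I_(k + \sum_(i < s) 2) -> V)
            (D : 'rV[A]_k) (d : 'I_s -> nat) (B : 'I_s -> 'M[A]_2),
       [/\ (k + 2 * s)%N = m,
           is_basis e,
           forall i, B i \in unitmx /\ skew_hermitian star (B i) &
           gram h e =
             block_mx (diag_mx D) 0
                      0 (\mxdiag_(i < s) (y ^+ d i *: B i))]).
Proof.
case: hV => v0 /(full_splitting hA h2 hstar hy hystar heps hh) [v [sigma S]].
have orth i j : j != i -> j != sigma i -> h (v i) (v j) = 0.
  by apply: (split_orth S); rewrite inE.
have sigmaK := split_inv S.
split=> [unram|ram].
  exists v; split; first exact: split_basis S.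
  apply/is_diag_mxP => i j ij; rewrite mxE.
  (* A pair swapped by [sigma] exists only in the ramified case. *)
  have si : sigma i = i by apply: contra_notP unram => /eqP /(split_block S) [].
  by apply: orth; rewrite ?si eq_sym.
pose F := [set i | sigma i == i]; pose P := [set i : 'I_m | (i < sigma i)%N].
have blk (b : 'I_#|P|) : exists dB : nat * 'M[A]_2,
    [/\ dB.2 \in unitmx, skew_hermitian star dB.2 &
      gram h (fun i : 'I_2 => v (if i == 0 then enum_val b else sigma (enum_val b)))
        = y ^+ dB.1 *: dB.2].
  have: sigma (enum_val b) != enum_val b.
    by apply/eqP => sb; have := enum_valP b; rewrite inE sb ltnn.
  case/(split_block S) => _ [d [B [uB sB gB]]]; exists (d, B); split=> //=.
  by rewrite -gB; apply/matrixP => i j; rewrite !mxE; do 2!case: eqP.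
have [dB dBP] := choice blk.
exists #|F|, #|P|, (v \o involution_enum (sigma := sigma)).
exists (\row_a h (v (enum_val a)) (v (enum_val a))).
exists (fun b => (dB b).1), (fun b => (dB b).2); split.
- exact: card_involution.
- by apply: reindex_basis (split_basis S); exact: involution_enum_bij.
- by move=> b; case: (dBP b).
set f := involution_enum (sigma := sigma).
have f_inj : injective f := bij_inj (involution_enum_bij sigmaK).
have fl a : f (lshift _ a) = enum_val a.
  by rewrite /f /involution_enum (unsplitK (inl a)).
have fr b : f (rshift _ b) = if (tagnat.sig2 b : 'I_2) == 0
    then enum_val (tagnat.sig1 b) else sigma (enum_val (tagnat.sig1 b)).
  by rewrite /f /involution_enum (unsplitK (inr b)).
have sl a : sigma (f (lshift _ a)) = f (lshift _ a) by rewrite fl fixed_enum.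
(* Thus [sigma] never links vectors of different blocks, which makes the off-diagonal blocks
   zero. *)
have sr b b' : f (rshift _ b') = sigma (f (rshift _ b)) ->
    tagnat.sig1 b = tagnat.sig1 b'.
  rewrite !fr; do 2![case: eqP => _]; rewrite ?sigmaK.
  - by move/(pair_enum_neq sigmaK).
  - by move/enum_val_inj.
  - by move/(inv_inj sigmaK)/enum_val_inj.
  - by move/esym/(pair_enum_neq sigmaK).
apply/matrixP => x1 x2; rewrite -(splitK x1) -(splitK x2).
case: (split x1) => a; case: (split x2) => b /=.
- rewrite block_mxEul !mxE; case: (eqVneq a b) => [->|ab]; first by rewrite /= fl.
  by apply: orth; rewrite /= ?sl (inj_eq f_inj) (inj_eq (@lshift_inj _ _)) eq_sym.
- rewrite block_mxEur !mxE.
  by apply: orth; rewrite /= ?sl (inj_eq f_inj) eq_rlshift.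
- rewrite block_mxEdl !mxE; apply: orth.
    by rewrite /= (inj_eq f_inj) eq_lrshift.
  by rewrite -(inj_eq (inv_inj sigmaK)) sl sigmaK (inj_eq f_inj) eq_lrshift.
rewrite block_mxEdr !mxE /=; case: (eqVneq (tagnat.sig1 a) (tagnat.sig1 b)) => ab.
  (* All blocks have size two, so the size conversion inside [\mxdiag] is the identity. *)
  rewrite conform_mx_id; have [_ _ /matrixP gB] := dBP (tagnat.sig1 a).
  have := gB (tagnat.sig2 a) (tagnat.sig2 b); rewrite !mxE => <-.
  by rewrite !fr -ab; do 2!case: eqP.
rewrite mxE; apply: orth; last by apply: contra_neq ab => /sr.
by rewrite /= (inj_eq f_inj) (inj_eq (@rshift_inj _ _)); apply: contra_neq ab => ->.
Qed.
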